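(* Let $n$, $p$, $g$ be integers with $p\ge 2$, $n-p\ge 1$ and $g\ge 0$, and let $C_{n,[p,n-p]}^{(g)}$ denote the number of partitions of the set $\{1,\ldots,n\}$ into two parts, of cardinalities $p$ and $n-p$, that have genus $g$. If $n\neq 2p$, then $$C_{n,[p,n-p]}^{(g)}=\frac{n}{g+1}\binom{p-1}{g}\binom{n-p-1}{g}.$$ If $n=2p$, then the right-hand side must be multiplied by $\tfrac12$, i.e. $$C_{2p,[p^2]}^{(g)}=\frac12\cdot\frac{2p}{g+1}\binom{p-1}{g}\binom{p-1}{g}.$$
   Context: Genus of a set partition: Let $\alpha$ be a partition of the set $\{1,\ldots,n\}$ into $|\alpha|$ nonempty parts. Associate with $\alpha$ the permutation $\tau$ of $\{1,\ldots,n\}$ whose cycles are the parts of $\alpha$, the elements of each cycle being written in increasing order (so $\tau$ sends each element to the next larger element of its part, and the largest element of a part to the smallest one). Let $\sigma=(1,2,\ldots,n)$ be the cyclic permutation $i\mapsto i+1$ modulo $n$. Products are compositions: $(\sigma\circ\tau^{-1})(x)=\sigma(\tau^{-1}(x))$. Let $\#\mathrm{cy}(\pi)$ denote the number of cycles of a permutation $\pi$, fixed points included. The genus $g=g(\alpha)$ is the non-negative integer defined by $$n+2-2g=\#\mathrm{cy}(\tau)+\#\mathrm{cy}(\sigma)+\#\mathrm{cy}(\sigma\circ\tau^{-1}),$$ equivalently $-2g=|\alpha|-1-n+\#\mathrm{cy}(\sigma\circ\tau^{-1})$. Partitions are unordered: the parts of a set partition are not labeled. Binomial coefficients $\binom{a}{b}$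 with $0\le a<b$ are $0$. *)

(* Defs.v *)
From mathcomp Require Import all_boot all_fingroup.

Set Implicit Arguments.
Unset Strict Implicit.
Unset Printing Implicit Defensive.

(* The set {1, ..., n} is represented by 'I_n = {0, ..., n-1}; the shift
   i |-> i - 1 preserves the order and the cyclic order, which are all that
   the definitions below use. *)

(* ordS n i has value i.+1 %% n. *)
Definition long_cycle (n : nat) : {perm 'I_n} := perm (@ordS_inj n).

Lemma next_enum_inj (n : nat) (B : {set 'I_n}) : injective (next (enum B)).
Proof. exact: can_inj (prev_next (enum_uniq B)). Qed.

(* enum B lists B in increasing order, so this is the single cycle on B that
   sends each element to the next larger one and the largest to the smallest;
   next fixes the elements outside B. *)
Definition part_cycle (n : nat) (B : {set 'I_n}) : {perm 'I_n} :=
  perm (@next_enum_inj n B).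

(* When the parts are disjoint the factors commute, and the cycles of the
   product are exactly the parts (see partition_permE). *)
Definition partition_perm (n : nat) (P : {set {set 'I_n}}) : {perm 'I_n} :=
  (\prod_(B in P) part_cycle B)%g.

Lemma partition_permE (n : nat) (P : {set {set 'I_n}}) (x : 'I_n) :
  partition P [set: 'I_n] -> partition_perm P x = next (enum (pblock P x)) x.
Proof.
move=> /and3P[/eqP covP tP _].
have xP : pblock P x \in P by rewrite pblock_mem ?covP ?inE.
have fixout (B : {set 'I_n}) y : y \notin B -> part_cycle B y = y.
  by move=> yB; rewrite permE next_nth mem_enum (negPf yB).
have stab (B : {set 'I_n}) y : (part_cycle B y \in B) = (y \in B).
  case: (boolP (y \in B)) => yB; last by rewrite fixout // (negPf yB).
  by rewrite permE -mem_enum mem_next mem_enum.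
suff main (s : seq {set 'I_n}) : uniq s -> {subset s <= P} -> (\prod_(B <- s) part_cycle B)%g x =
    if pblock P x \in s then part_cycle (pblock P x) x else x.
  rewrite /partition_perm -big_filter main ?filter_uniq ?index_enum_uniq //.
    by rewrite mem_filter xP mem_index_enum permE.
  by move=> B; rewrite mem_filter => /andP[].
elim/last_ind: s => [|s B IH]; first by rewrite big_nil perm1.
rewrite rcons_uniq => /andP[Bs us] sP.
have BP : B \in P by apply: sP; rewrite mem_rcons mem_head.
rewrite -cats1 big_cat big_seq1 cats1 /= permM IH //; last first.
  by move=> C Cs; apply: sP; rewrite mem_rcons inE Cs orbT.
rewrite mem_rcons inE; case: (eqVneq (pblock P x) B) => [->|neq] /=.
  by rewrite (negPf Bs).
have disj y : y \in pblock P x -> y \notin B.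
  move=> yx; apply/negP => yB; case/eqP: neq.
  by rewrite -(def_pblock tP xP yx) (def_pblock tP BP yB).
have xx : x \in pblock P x by rewrite mem_pblock covP inE.
by case: ifP => _; apply: fixout; apply: disj; rewrite ?stab.
Qed.

Definition num_cycles (n : nat) (s : {perm 'I_n}) : nat := #|porbits s|.

(* The equation n + 2 - 2g = #cy(tau) + #cy(sigma) + #cy(sigma o tau^-1), with
   2g moved to the right so that no truncated subtraction occurs. It determines
   g. Permutations multiply left to right, (s * t) x = t (s x), so
   sigma o tau^-1 is tau^-1 * sigma. *)
Definition has_genus (n : nat) (P : {set {set 'I_n}}) (g : nat) : bool :=
  let tau := partition_perm P in
  let sigma := long_cycle n in
  n + 2 == num_cycles tau + num_cycles sigma + num_cycles (tau^-1 * sigma)%g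
           + 2 * g.

(* Equality of the multiset of part sizes with the given list. *)
Definition has_type (n : nat) (P : {set {set 'I_n}}) (lambda : seq nat) : bool :=
  perm_eq [seq #|B| | B : {set 'I_n} <- enum P] lambda.

Definition num_partitions (n : nat) (lambda : seq nat) (g : nat) : nat :=
  #|[set P : {set {set 'I_n}} |
      [&& partition P [set: 'I_n], has_type P lambda & has_genus P g]]|.

(* Main.v *)
Require Import Defs.
From mathcomp Require Import all_boot all_order all_algebra all_fingroup.
From mathcomp Require Import zify ring.
Import GRing.Theory.
Local Open Scope ring_scope.

Set Implicit Arguments.
Unset Strict Implicit.
Unset Printing Implicit Defensive.

(** Let A, of size p, be one of the two blocks, q = n - p, tau the permutation
    of the partition {A, ~: A} and sigma the long cycle. Call boundary the set
    D of the points where a maximal cyclic run of one of the blocks starts.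

    If y + 1 is in the block of y then tau y = y + 1. Otherwise y + 1 starts a
    run of the other block, and tau y, the next element of the block of y, is
    the start of the run after that one: the next element of D after y + 1. In
    both cases tau y = c (sigma y), where c is the cyclic successor on D and
    the identity elsewhere ([next_enum_boundary]). So sigma o tau^-1 is the
    inverse of c, which has one cycle on D and n - #|D| fixed points. In the
    genus equation this leaves #|D| = 2 (g + 1): the genus of a partition into
    two blocks is one less than the number k of cyclic runs of each block
    ([has_genus_setC]).

    It remains to count. A partition is determined by its block containing the
    first point, and that block by the word over bool that its membership
    predicate spells, a word beginning with true; #|D| is the number of letter
    changes around that word read cyclically. Suppose that it has p letters true
    in k cyclic runs and q letters false in k runs. Such a word amounts to a
    composition of q into k parts and one of p + 1 into k + 1 parts: the runs of
    true in linear order, once the first letter is repeated at the end, where it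
    may form a run by itself. So there are 'C(q - 1, k - 1) * 'C(p, k) such
    words, as proved in [num_words_closed_form] by recursion on the first
    letter. With k = g + 1 this equals
    p / (g + 1) * 'C(p - 1, g) * 'C(q - 1, g). If p and q differ, the block of
    the first point may have either size, and the two contributions add up to
    the factor n = p + q; if p = q there is only one, with the factor
    p = n / 2. *)

(** * Cyclic successors and boundaries *)

Section Successor.
Local Open Scope nat_scope.
Context (m : nat).
Implicit Types (A B : {set 'I_m.+1}) (x y : 'I_m.+1).
Local Notation sigma := (long_cycle m.+1).

Lemma fcycle_enum_ord : fcycle sigma (enum 'I_m.+1).
Proof.
have -> : enum 'I_m.+1 = ord0 :: behead (enum 'I_m.+1) by rewrite enum_ordSl.
apply/(pathP ord0) => i.
rewrite size_rcons size_behead size_enum_ord /= => lt_i.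
have nthE k : k < m -> nth ord0 (behead (enum 'I_m.+1)) k = k.+1 :> nat.
  by move=> lt_k; rewrite nth_behead nth_enum_ord.
have hdE : nth ord0 (ord0 :: rcons (behead (enum 'I_m.+1)) ord0) i = i :> nat.
  case: i lt_i => [//|i] lt_i /=.
  by rewrite nth_rcons size_behead size_enum_ord /= -ltnS lt_i nthE.
apply/eqP/val_inj; rewrite permE /= hdE nth_rcons size_behead size_enum_ord /=.
have [lt_im|->] : i < m \/ i = m by lia.
  by rewrite lt_im nthE // modn_small.
by rewrite ltnn eqxx modnn.
Qed.

(** Rotating the enumeration of the ordinals to begin at x turns it into the
    sigma-trajectory of x; filtering by B commutes with the rotation up to
    another rotation, which does not affect [next]. The trajectory below ends
    with x itself, so that the head exists even if B is a singleton. *)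
Lemma next_enum_head B x : x \in B ->
  next (enum B) x = head x [seq y <- traject sigma (sigma x) m.+1 | y \in B].
Proof.
move=> xB; set c := enum 'I_m.+1.
have [|i s defc] := @rot_to _ c x; first by rewrite mem_enum.
have pth : fpath sigma x (rcons s x).
  by have := fcycle_enum_ord; rewrite -(rot_cycle i) -/c defc.
have szs : (size s).+1 = m.+1.
  by rewrite -[_.+1]/(size (x :: s)) -defc size_rot size_enum_ord.
have -> : traject sigma (sigma x) m.+1 = rcons s x.
  have /fpathP[k defs] := pth.
  rewrite defs; congr traject.
  by rewrite -szs -(size_rcons s x) defs size_traject.
have enumB : enum B
    = [seq y <- take i c | y \in B] ++ [seq y <- drop i c | y \in B].
  by rewrite -filter_cat cat_take_drop {1}/enum_mem -enumT; apply: eq_filter.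
have rotB : [seq y <- rot i c | y \in B]
    = rot (size [seq y <- take i c | y \in B]) (enum B).
  by rewrite enumB rot_size_cat -filter_cat.
rewrite -(next_rot (size [seq y <- take i c | y \in B])) ?enum_uniq //.
rewrite -rotB defc /= xB filter_rcons xB.
by case: [seq _ <- _ | _] => [|y s'] /=; rewrite eqxx.
Qed.

(** [next (enum B)] is the first return map of sigma to B. In this form it no
    longer refers to the linear order on the ordinals, only to the cyclic one. *)
Lemma next_enum_first_return B x d : d <= m -> x \in B ->
    iter d.+1 sigma x \in B ->
    (forall i, 0 < i <= d -> iter i sigma x \notin B) ->
  next (enum B) x = iter d.+1 sigma x.
Proof.
move=> le_d xB retB firstB; rewrite next_enum_head //.
have -> : traject sigma (sigma x) m.+1
    = traject sigma (sigma x) (d + (m - d).+1).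
  by congr traject; lia.
rewrite trajectD filter_cat trajectS /= -iterSr retB.
rewrite (_ : [seq _ <- traject _ _ d | _] = [::]) //.
apply/eqP; rewrite -[_ == _]negbK -has_filter.
apply/hasPn => y /trajectP[i lt_i ->].
by rewrite -iterSr firstB.
Qed.

Lemma next_enum_notin B x : x \notin B -> next (enum B) x = x.
Proof. by move=> xB; rewrite next_nth mem_enum (negPf xB). Qed.

Lemma iter_long_cycle x : iter m.+1 sigma x = x.
Proof.
have it i : iter i sigma x = (x + i) %% m.+1 :> nat.
  elim: i => [|i IH]; first by rewrite addn0 modn_small.
  by rewrite iterS permE /= IH -addn1 modnDml addn1 addnS.
by apply: val_inj; rewrite /= -iterS it modnDr modn_small.
Qed.

(** The starts of the cyclic runs of A and of its complement. *)
Definition boundary A := sigma @: [set y | (y \in A) != (sigma y \in A)].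

Lemma mem_boundary A y :
  (sigma y \in boundary A) = ((y \in A) != (sigma y \in A)).
Proof. by rewrite mem_imset ?inE //; apply: perm_inj. Qed.

Lemma boundaryC A : boundary (~: A) = boundary A.
Proof.
apply: (congr1 (fun E : {set _} => sigma @: E)).
apply/setP => y; rewrite !inE.
by case: (y \in A); case: (_ \in A).
Qed.

(** With d + 1 the first return time of y to A, the points sigma y, ...,
    sigma^d y form a run of the complement of A; for d > 0 both this run and the
    run of A starting at sigma^(d + 1) y start in the boundary, with no boundary
    point strictly between the two starts. For d = 0, sigma y is not in the
    boundary and [next] fixes it. *)
Lemma next_enum_boundary A y : y \in A ->
  next (enum A) y = next (enum (boundary A)) (sigma y).
Proof.
move=> yA.
have ex_d : exists d, iter d.+1 sigma y \in A.
  by exists m; rewrite iter_long_cycle.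
case: (ex_minnP ex_d) => d retA mind.
have le_d : d <= m by apply: mind; rewrite iter_long_cycle.
have notA i : 0 < i <= d -> iter i sigma y \notin A.
  case: i => // i lt_i; apply/negP => /mind; lia.
rewrite (next_enum_first_return le_d yA retA notA).
case: d le_d retA mind notA => [|d] le_d retA mind notA.
  by rewrite next_enum_notin // mem_boundary yA retA.
rewrite (@next_enum_first_return _ _ d) -?iterSr //.
- exact: ltnW.
- by rewrite mem_boundary yA (notA 1).
- by rewrite iterS mem_boundary -iterS retA (negPf (notA d.+1 _)) ?ltnSn.
- move=> i /andP[i0 le_i]; rewrite -iterSr iterS mem_boundary -iterS.
  by rewrite (negPf (notA i _)) ?(negPf (notA i.+1 _)) ?i0 //; lia.
Qed.

Lemma porbit_next_enum (s : {perm 'I_m.+1}) B x :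
    (forall y, y \in B -> s y = next (enum B) y) -> x \in B ->
  porbit s x = B.
Proof.
move=> sB xB; apply/setP => y.
have cyc : fcycle s (enum B).
  rewrite (eq_in_cycle (P := mem B) (e' := frel (next (enum B)))).
  - exact: cycle_next (enum_uniq B).
  - by move=> u v uB _ /=; rewrite sB.
  - by apply/allP => u; rewrite mem_enum.
rewrite -(mem_enum B) -(fconnect_cycle cyc (x := x)) ?mem_enum //.
apply/porbitP/idP => [[i ->]|/iter_findex <-].
  by rewrite permX fconnect_iter.
by exists (findex s x y); rewrite permX.
Qed.

Lemma num_cycles_part_cycle B :
  B != set0 -> num_cycles (part_cycle B) + #|B| = m.+2.
Proof.
case/set0Pn => x xB.
have pB y : y \in B -> porbit (part_cycle B) y = B.
  by apply: porbit_next_enum => z _; rewrite permE.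
have pNB y : y \notin B -> porbit (part_cycle B) y = [set y].
  move=> yB; apply: porbit_next_enum; rewrite ?set11 // => z /set1P->.
  by rewrite permE next_enum_notin // enum_set1 /= eqxx.
have -> : num_cycles (part_cycle B) = #|B |: set1 @: ~: B|.
  congr #|pred_of_set _|; apply/setP => C; rewrite !inE; apply/imsetP/idP.
    case=> y _ ->; have [/pB->|yB] := boolP (y \in B); first by rewrite eqxx.
    by rewrite pNB // imset_f ?orbT // inE.
  case/orP => [/eqP->|/imsetP[y]]; first by exists x; rewrite ?pB.
  by rewrite inE => yB ->; exists y; rewrite ?pNB.
rewrite cardsU1 card_imset; last exact: set1_inj.
have -> : (B \notin set1 @: ~: B).
  apply/imsetP => -[y]; rewrite inE => /negP yB defB.
  by apply: yB; rewrite defB set11.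
have := cardsC B; rewrite card_ord; lia.
Qed.

Lemma num_cycles_long_cycle : num_cycles sigma = 1.
Proof.
have -> : sigma = part_cycle [set: 'I_m.+1].
  apply/permP => x; rewrite [RHS]permE (@next_enum_first_return _ _ 0) ?inE //.
  by case=> // i; rewrite ltn0 andbF.
have /num_cycles_part_cycle : [set: 'I_m.+1] != set0.
  by apply/set0Pn; exists ord0.
by rewrite cardsT card_ord; lia.
Qed.

(** A set with empty boundary is invariant under sigma, which is transitive. *)
Lemma boundary_neq0 A : ord0 \in A -> A != setT -> boundary A != set0.
Proof.
move=> A0; apply: contra_neq => bA0; apply/setP => x; rewrite inE.
have stab i : iter i sigma ord0 \in A.
  elim: i => // i IH; have : iter i.+1 sigma ord0 \notin boundary A.
    by rewrite bA0 inE.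
  by rewrite iterS mem_boundary IH negbK => /eqP <-.
have : fconnect sigma ord0 x.
  by rewrite (fconnect_cycle fcycle_enum_ord) mem_enum.
by move/iter_findex <-; apply: stab.
Qed.

(** * Partitions into two blocks *)

Lemma partition_setC A : A != set0 -> A != setT ->
  partition [set A; ~: A] [set: 'I_m.+1].
Proof.
move=> A0 AT; apply/and3P; split.
- by rewrite /cover bigcup_setU !big_set1 setUCr.
- apply/trivIsetP => B C /set2P[]-> /set2P[]->; rewrite ?eqxx // => _.
    by rewrite -setI_eq0 setICr.
  by rewrite -setI_eq0 setIC setICr.
- rewrite !inE negb_or eq_sym A0 eq_sym; apply: contra_neq AT => AC.
  by rewrite -[A]setCK AC setC0.
Qed.

Lemma partition_two_blocks (P : {set {set 'I_m.+1}}) x :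
  partition P setT -> #|P| = 2 -> P = [set pblock P x; ~: pblock P x].
Proof.
move=> /and3P[/eqP covP tP P0] /eqP/cards2P[B [C [neqBC defP]]].
have BP : B \in P by rewrite defP !inE eqxx.
have CP : C \in P by rewrite defP !inE eqxx orbT.
have defC : C = ~: B.
  apply/eqP; rewrite eqEsubset -disjoints_subset disjoint_sym.
  rewrite ((trivIsetP tP) _ _ BP CP neqBC) /=; apply/subsetP => y yB.
  have := in_setT y; rewrite -covP defP /cover bigcup_setU !big_set1 !inE.
  by rewrite inE in yB; rewrite (negPf yB).
have : pblock P x \in P by rewrite pblock_mem // covP inE.
set Z := pblock P x; rewrite defP defC => /set2P[]->; first by [].
by rewrite setCK setUC.
Qed.

(** As sigma^-1 * tau is the cyclic successor on the boundary, its inverse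
    tau^-1 * sigma has m + 2 - #|boundary A| cycles. *)
Lemma has_genus_setC A g : ord0 \in A -> A != setT ->
  has_genus [set A; ~: A] g = (#|boundary A| == g.+1.*2).
Proof.
move=> A0 AT; rewrite /has_genus; set P := [set A; ~: A].
have An0 : A != set0 by apply/set0Pn; exists ord0.
have partP : partition P setT by apply: partition_setC.
have tauE y : partition_perm P y = next (enum (pblock P y)) y.
  exact: partition_permE.
have /and3P[/eqP covP tP P0] := partP.
have blockE B y : B \in P -> y \in B -> pblock P y = B.
  by move=> BP yB; apply: def_pblock.
have AP : A \in P by rewrite !inE eqxx.
have CP : ~: A \in P by rewrite !inE eqxx orbT.
have inPblock y : y \in pblock P y by rewrite mem_pblock covP inE.
have tau2 : num_cycles (partition_perm P) = 2.
  have porbE y : porbit (partition_perm P) y = pblock P y.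
    apply: porbit_next_enum; rewrite ?inPblock // => z zy.
    by rewrite tauE (@blockE (pblock P y)) // pblock_mem // covP inE.
  have -> : num_cycles (partition_perm P) = #|P|.
    congr #|pred_of_set _|; apply/setP => B; apply/imsetP/idP => [[y _ ->]|BP].
      by rewrite porbE pblock_mem // covP inE.
    have /set0Pn[y yB] : B != set0 by apply: contraNneq P0 => <-.
    by exists y; rewrite // porbE (@blockE B).
  rewrite cards2; case: eqVneq => // eqA.
  by have := A0; rewrite eqA inE A0.
have rhoE : ((partition_perm P)^-1 * sigma = (part_cycle (boundary A))^-1)%g.
  apply: invg_inj; rewrite invgK invMg invgK; apply/permP => x.
  rewrite permM tauE [RHS]permE.
  have [y ->] : exists y, x = sigma y by exists (sigma^-1 x)%g; rewrite permKV.
  rewrite permK; have [yA|yA] := boolP (y \in A).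
    by rewrite (blockE _ _ AP yA) // next_enum_boundary.
  have yC : y \in ~: A by rewrite inE.
  by rewrite (blockE _ _ CP yC) next_enum_boundary // boundaryC.
rewrite rhoE tau2 num_cycles_long_cycle /num_cycles porbitsV.
have := num_cycles_part_cycle (boundary_neq0 A0 AT).
rewrite /num_cycles; lia.
Qed.

Lemma has_type_setC A p q : p + q = m.+1 ->
  has_type [set A; ~: A] [:: p; q] = (#|A| == p) || (#|A| == q).
Proof.
move=> pq; rewrite /has_type.
have cardAC : #|~: A| = m.+1 - #|A|.
  by have := cardsC A; rewrite card_ord; lia.
have neqA : A != ~: A.
  by apply/eqP => /setP/(_ ord0); rewrite inE; case: (_ \in A).
have /(perm_map (fun B : {set _} => #|B|)) /permPl -> :
    perm_eq (enum [set A; ~: A]) [:: A; ~: A].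
  apply: uniq_perm; rewrite ?enum_uniq //= ?inE ?neqA // => B.
  by rewrite mem_enum !inE.
rewrite /= cardAC; have := max_card (mem A); rewrite card_ord => leA.
apply/idP/orP => [/perm_mem/(_ #|A|)|[]/eqP eqA].
- by rewrite !inE eqxx => /esym/orP.
- by rewrite eqA -pq addKn.
- by rewrite eqA -pq addnK -[[:: q; p]]/([:: q] ++ [:: p]) perm_catC.
Qed.

(** Choosing the block of [ord0] selects one of the two blocks even if they have
    the same size, so no division by 2 arises when p = q. *)
Lemma num_partitions_two_blocks p q g : 0 < p -> 0 < q -> p + q = m.+1 ->
  num_partitions m.+1 [:: p; q] g =
  #|[set A : {set 'I_m.+1} | [&& ord0 \in A, (#|A| == p) || (#|A| == q)
                              & #|boundary A| == g.+1.*2]]|.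
Proof.
move=> p0 q0 pq; set S := [set A | _]; pose f A := [set A; ~: A].
have SP A : A \in S -> [/\ ord0 \in A, A != set0 & A != setT].
  rewrite inE => /and3P[A0 cA _]; split=> //.
    by apply/set0Pn; exists ord0.
  by apply/eqP => AT; move: cA; rewrite AT cardsT card_ord; lia.
have injf : {in S &, injective f}.
  move=> A B /SP[A0 _ _] /SP[B0 _ _] /setP/(_ A).
  by rewrite !inE eqxx => /esym/orP[]/eqP// defA; move: A0; rewrite defA inE B0.
rewrite -(card_in_imset injf) /num_partitions; congr #|pred_of_set _|.
apply/setP => P; rewrite inE.
apply/and3P/imsetP => [[partP typeP genP]|[A AS ->]].
  have cardP : #|P| = 2 by move/perm_size: typeP; rewrite size_map -cardE.
  have defP := partition_two_blocks ord0 partP cardP.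
  have /and3P[/eqP covP tP P0] := partP.
  have A0 : ord0 \in pblock P ord0 by rewrite mem_pblock covP inE.
  have AT : pblock P ord0 != setT.
    by apply: contraNneq P0 => AT; rewrite defP AT setCT !inE eqxx orbT.
  exists (pblock P ord0) => //; rewrite inE A0 /=.
  by rewrite -(has_type_setC _ pq) -(has_genus_setC _ A0 AT) -defP typeP.
have [A0 An0 AT] := SP A AS; move: AS; rewrite inE => /and3P[_ cA bA].
by rewrite partition_setC // has_type_setC // has_genus_setC.
Qed.

End Successor.

(** * Counting words by letter changes *)

Section Words.
Local Open Scope nat_scope.

Definition changes (b : bool) (w : seq bool) := count id (pairmap addb b w).

Lemma card_nth_true n (s : seq bool) : size s = n ->
  #|[set i : 'I_n | nth false s i]| = count id s.
Proof.
move=> <-{n}; rewrite -sum1dep_card big_mkcond /=.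
elim: s => [|b s IH] /=; first by rewrite big_ord0.
by rewrite big_ord_recl /= -IH; case: b.
Qed.

Definition word_set m (w : m.-tuple bool) : {set 'I_m.+1} :=
  [set i : 'I_m.+1 | nth false (true :: w) i].

Lemma word_set_inj m : injective (@word_set m).
Proof.
move=> v w /setP eqvw; apply: val_inj; apply: (@eq_from_nth _ false).
  by rewrite !size_tuple.
move=> i; rewrite size_tuple -ltnS => lt_i.
by have := eqvw (Ordinal lt_i); rewrite !inE.
Qed.

Lemma word_set_surj m (A : {set 'I_m.+1}) :
  ord0 \in A -> exists w, A = word_set w.
Proof.
move=> A0; set w := [tuple lift ord0 i \in A | i < m]; exists w.
apply/setP => i; rewrite inE; case: (unliftP ord0 i) => [j|] -> //.
have -> : nth false (true :: w) (lift ord0 j) = tnth w j.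
  by rewrite lift0 (tnth_nth false).
by rewrite tnth_mktuple.
Qed.

Lemma card_word_set m (w : m.-tuple bool) : #|word_set w| = (count id w).+1.
Proof. by rewrite card_nth_true //= size_tuple. Qed.

(** The letter true appended to w is the first letter of [true :: w], so the
    change across the end of the cyclic word is counted as well. *)
Lemma card_boundary_word_set m (w : m.-tuple bool) :
  #|boundary (word_set w)| = changes true (rcons w true).
Proof.
rewrite card_imset; last exact: perm_inj.
rewrite /changes -(@card_nth_true m.+1); last first.
  by rewrite size_pairmap size_rcons size_tuple.
apply: eq_card => y.
rewrite !inE (nth_pairmap false) ?size_rcons ?size_tuple //.
rewrite permE -rcons_cons nth_rcons /= size_tuple ltn_ord -negb_eqb.
congr (~~ (_ == _)).
rewrite nth_rcons size_tuple /=.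
have [lt_y|->] : y < m \/ y = m :> nat by have := ltn_ord y; lia.
  by rewrite lt_y modn_small.
by rewrite ltnn eqxx modnn.
Qed.

(** Words w with p letters true for which the word b w true has c changes; the
    letter b stands for the letter read before w, which makes a recursion on the
    first letter possible. *)
Definition num_words n (b : bool) p c :=
  #|[set w : n.-tuple bool |
      (count id w == p) && (changes b (rcons w true) == c)]|.

Lemma card_tupleS n (P : pred (seq bool)) :
  #|[set w : n.+1.-tuple bool | P w]| =
  #|[set w : n.-tuple bool | P (true :: w)]|
  + #|[set w : n.-tuple bool | P (false :: w)]|.
Proof.
rewrite -!sum1dep_card.
rewrite (reindex (fun u : bool * n.-tuple bool => cons_tuple u.1 u.2)) /=;
  last first.
  exists (fun w => (thead w, behead_tuple w)) => [[b w] _|w _] /=.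
    by congr pair; apply: val_inj.
  by rewrite [RHS]tuple_eta; apply: val_inj.
rewrite big_mkcond /=.
rewrite -(pair_bigA _ (fun b (w : n.-tuple bool) => if P (b :: w) then 1 else 0)).
by rewrite /= big_bool /= -!big_mkcond.
Qed.

Lemma num_words0 b p c :
  num_words 0 b p c = (p == 0) && (c == ~~ b :> nat).
Proof.
rewrite /num_words -sum1dep_card big_mkcond (big_pred1 [tuple]) /=; last first.
  by move=> w; rewrite (tuple0 w); apply/esym/eqP.
by rewrite /changes /= addbT addn0 ![0 == _]eq_sym ![_ == c]eq_sym; case: ifP.
Qed.

Lemma num_words_gt n b p c : n < p -> num_words n b p c = 0.
Proof.
move=> lt_np; apply/eqP; rewrite cards_eq0 -subset0; apply/subsetP => w.
rewrite !inE => /andP[/eqP cw _].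
by have := count_size id w; rewrite cw size_tuple leqNgt lt_np.
Qed.

Lemma num_words_cons n b p c :
  num_words n.+1 b p c.+1 =
  (if p is p'.+1 then num_words n true p' (b + c) else 0)
  + num_words n false p (~~ b + c).
Proof.
rewrite /num_words.
rewrite (card_tupleS n (fun w =>
  (count id w == p) && (changes b (rcons w true) == c.+1))).
have shift (a : bool) k : (a + k == c.+1) = (k == ~~ a + c) by case: a.
congr (_ + _); last first.
  by apply: eq_card => w; rewrite !inE /changes /= addbF shift.
case: p => [|p].
  by apply/eqP; rewrite cards_eq0; apply/eqP/setP => w; rewrite !inE.
by apply: eq_card => w; rewrite !inE /changes /= addbT shift negbK.
Qed.

Lemma num_words_true0 n p : num_words n true p 0 = (p == n).
Proof.
elim: n p => [|n IH] p; first by rewrite num_words0 andbT.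
rewrite /num_words.
rewrite (card_tupleS n (fun w =>
  (count id w == p) && (changes true (rcons w true) == 0))).
rewrite [X in _ + X]eq_card0 ?addn0 => [|w]; last first.
  by rewrite !inE /changes /= andbF.
case: p => [|p]; first by rewrite eq_card0 // => w; rewrite !inE.
by rewrite eqSS -IH; apply: eq_card => w; rewrite !inE.
Qed.

(** Both formulas are proved together since the recursion on the first letter
    relates them; each step is Pascal's rule. Between two letters true the number
    of changes is even, and after false it is odd. *)
Lemma num_words_closed_form n p q k : p + q = n ->
  num_words n false p k.*2.+1 = 'C(q, k) * 'C(p, k) /\
  num_words n true p k.*2.+2 =
    (if q is q'.+1 then 'C(q', k) * 'C(p.+1, k.+1) else 0).
Proof.
elim: n p q k => [|n IH] p q k pq.
  have [-> ->] : p = 0 /\ q = 0 by lia.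
  by rewrite !num_words0; case: k.
split; rewrite num_words_cons /= ?add0n ?add1n ?addn0.
  case: q pq => [|q] pq.
    rewrite num_words_gt ?addn0; last by lia.
    case: p pq => [//|p] pq.
    case: k => [|k].
      by rewrite num_words_true0 (_ : p == n = true) ?bin0; lia.
    by rewrite doubleS; have [_ ->] := IH p 0 k ltac:(lia).
  have [-> _] := IH p q k ltac:(lia).
  case: p pq => [|p] pq.
    by case: k => [|k]; rewrite ?bin0 // bin0n !muln0.
  case: k => [|k].
    by rewrite num_words_true0 !bin0 (_ : (p == n) = false) //; lia.
  rewrite doubleS; have [_ ->] := IH p q.+1 k ltac:(lia).
  by rewrite -mulnDl addnC -binS.
case: q pq => [|q] pq.
  rewrite num_words_gt ?addn0; last lia.
  case: p pq => [//|p] pq.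
  by have [_ ->] := IH p 0 k ltac:(lia).
have [-> _] := IH p q k ltac:(lia).
case: p pq => [|p] pq.
  by rewrite binS mulnDr bin0n muln0.
have [_ ->] := IH p q.+1 k ltac:(lia).
by rewrite -mulnDr -binS.
Qed.

Lemma num_partitions_num_words m p q g : p + q = m.+1 -> 0 < p -> 0 < q ->
  num_partitions m.+1 [:: p; q] g =
  num_words m true p.-1 g.+1.*2
  + (if p == q then 0 else num_words m true q.-1 g.+1.*2).
Proof.
move=> pq p0 q0; rewrite num_partitions_two_blocks //; set S := [set A | _].
pose W (r : nat) := [set w : m.-tuple bool |
  (count id w == r.-1) && (changes true (rcons w true) == g.+1.*2)].
have -> : S = (@word_set m) @: (W p :|: W q).
  apply/setP => A; apply/idP/imsetP => [|[w wW ->]].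
    rewrite inE => /and3P[/word_set_surj[w ->] cA bA]; exists w => //.
    rewrite !inE -card_boundary_word_set bA !andbT.
    by move: cA; rewrite card_word_set; lia.
  rewrite !inE /= card_word_set card_boundary_word_set.
  by move: wW; rewrite !inE -andb_orl => /andP[cA ->]; lia.
rewrite card_imset; last exact: word_set_inj.
case: eqP => [->|neq_pq]; first by rewrite setUid addn0.
rewrite cardsU (_ : W p :&: W q = set0) ?cards0 ?subn0 //.
by apply/setP => w; rewrite !inE; lia.
Qed.

(** 'C(p + 1, g + 1) * (g + 1) = (p + 1) * 'C(p, g) is what turns the count into
    the symmetric form. *)
Lemma num_words_true m p q g : p.+1 + q.+1 = m.+1 ->
  num_words m true p g.+1.*2 * g.+1 = p.+1 * 'C(p, g) * 'C(q, g).
Proof.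
move=> pq; rewrite doubleS.
have [_ ->] := @num_words_closed_form m p q.+1 g ltac:(lia).
by rewrite -mulnA [_ * g.+1]mulnC -mul_bin_diag mulnC.
Qed.

End Words.

Theorem proposition14 (n p g : nat) (hp : (2 <= p)%N) (hnp : (1 <= n - p)%N) :
  (n <> (2 * p)%N ->
     (num_partitions n [:: p; (n - p)%N] g)%:R =
       n%:R / g.+1%:R * 'C(p - 1, g)%:R * 'C(n - p - 1, g)%:R :> rat) /\
  (n = (2 * p)%N ->
     (num_partitions n [:: p; p] g)%:R =
       1 / 2%:R * ((2 * p)%N%:R / g.+1%:R * 'C(p - 1, g)%:R * 'C(p - 1, g)%:R)
       :> rat).
Proof.
have g0 : g.+1%:R != 0 :> rat by rewrite Num.Theory.pnatr_eq0.
have wordsE m a b : (a.+1 + b.+1 = m.+1)%N ->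
    (num_words m true a g.+1.*2)%:R
      = a.+1%:R * 'C(a, g)%:R * 'C(b, g)%:R / g.+1%:R :> rat.
  move=> ab; apply: (canRL (mulfK g0)).
  by rewrite -!natrM (num_words_true _ ab).
have [a defp] : {a | p = a.+1} by exists p.-1; lia.
have [b defq] : {b | (n - p)%N = b.+1} by exists (n - p).-1%N; lia.
have defn : n = (a + b).+2 by lia.
have ab : (a.+1 + b.+1 = (a + b).+2)%N by lia.
have ba : (b.+1 + a.+1 = (a + b).+2)%N by lia.
rewrite defq defp !subSS !subn0; split=> n2p.
  have neq_ab : (a.+1 == b.+1) = false by lia.
  rewrite defn num_partitions_num_words // neq_ab natrD.
  rewrite (wordsE _ _ _ ab) (wordsE _ _ _ ba) -ab natrD.
  by field; rewrite nat1r.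
have eq_ab : b = a by lia.
move: ab; rewrite eq_ab => aa.
rewrite defn eq_ab num_partitions_num_words // eqxx addn0.
rewrite (wordsE _ _ _ aa) natrM.
by field; rewrite nat1r.
Qed.
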